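(* Let $\mathcal{N}$ be a power network description as in the context, with private line conductances $\mathbf{g}=(g_{ij})_{(i,j)\in E}\in\mathbb{R}^n$ and susceptances $\mathbf{b}=(b_{ij})_{(i,j)\in E}\in\mathbb{R}^n$. Fix $\alpha>0$, $\epsilon>0$, $\beta>0$ and $\lambda>0$. Then the Power Lines Obfuscation (PLO) mechanism described in the context, viewed as a randomized algorithm that maps the private line-parameter data to the released network description $\dot{\mathcal{N}}$, is $\epsilon$-differentially private with respect to the $\alpha$-indistinguishability adjacency relation.
   Context: Network data: a set of buses $N$ ($|N|=m$), a set $E$ of $n$ directed lines (transmission lines and transformers) and the set $E^R$ of the same lines with reversed direction; each line has admittance $Y_{ij}=g_{ij}+\mathbf{i}\,b_{ij}$ (conductance $g_{ij}$, susceptance $b_{ij}$). The remaining network data (bus demands $S^d_i$, generator bounds $S^{gl}_i,S^{gu}_i$, voltage bounds $v^l_i,v^u_i$, phase-angle-difference limits $\theta^\Delta_{ij}$, thermal limits $s^u_{ij}$, generation cost coefficients $c_{0i},c_{1i},c_{2i}$, a slack bus $s$), the optimal AC-OPF dispatch cost $O^*>0$ of $\mathcal{N}$, the vector of conductance/susceptance ratios $\mathbf{r}=(r_{ij})_{(i,j)\in E}$, and the partition of lines by voltage level ($E(v)$ = lines at voltage level $v\in VL(\mathcal{N})$, $n_v=|E(v)|$, each line in exactly one $E(v)$) are public. Write $\mathrm{cost}(S^g_i)=c_{2i}(\Re S^g_i)^2+c_{1i}\Re S^g_i+c_{0i}$. Laplace distribution: $\mathrm{Lap}(\lambda')$ has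 density $\frac{1}{2\lambda'}e^{-|x|/\lambda'}$; $\mathrm{Lap}(\lambda')^n$ denotes $n$ i.i.d. draws. Differential privacy: two private datasets $D,D'$ (here the line-parameter vectors) are $\alpha$-adjacent, $D\sim_\alpha D'$, if there is a single coordinate $i$ with $|D_i-D'_i|\le\alpha$ and $D_j=D'_j$ for all $j\neq i$. A randomized algorithm $\mathcal{A}$ is $\epsilon$-differentially private if for all $D\sim_\alpha D'$ and all measurable output sets $O$, $\Pr[\mathcal{A}(D)\in O]\le e^{\epsilon}\Pr[\mathcal{A}(D')\in O]$. PLO mechanism (input $\mathcal{N},O^*,\epsilon,\alpha,\beta$; all noise draws independent): 1. $\tilde{\mathbf{g}}=\mathbf{g}+z$, $z\sim\mathrm{Lap}(3\alpha/\epsilon)^n$. 2. $\tilde b_{ij}=r_{ij}\tilde g_{ij}$ for each line. 3. For each voltage level $v$: $\tilde\mu^v_{\mathbf g}=\frac{1}{n_v}\sum_{(i,j)\in E(v)}g_{ij}+\mathrm{Lap}(3\alpha/(n_v\epsilon))$ and $\tilde\mu^v_{\mathbf b}=\frac{1}{n_v}\sum_{(i,j)\in E(v)}b_{ij}+\mathrm{Lap}(3\alpha/(n_v\epsilon))$. 4. Solve (selecting a solution by any fixed rule) the problem with variables $S^g_i,V_i$ ($i\in N$), $\dot Y_{ij}=\dot g_{ij}+\mathbf{i}\dot b_{ij}$ and $S_{ij}$ ($(i,j)\in E\cup E^R$): minimize $\|\dot{\mathbf g}-\tilde{\mathbf g}\|_2^2+\|\dot{\mathbf b}-\tilde{\mathbf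 b}\|_2^2$ subject to $\angle V_s=0$; $v^l_i\le|V_i|\le v^u_i$; $-\theta^\Delta_{ij}\le\angle(V_iV_j^* )\le\theta^\Delta_{ij}$ for $(i,j)\in E$; $S^{gl}_i\le S^g_i\le S^{gu}_i$; $|S_{ij}|\le s^u_{ij}$; $S^g_i-S^d_i=\sum_{(i,j)\in E\cup E^R}S_{ij}$; $\frac{|\sum_{i\in N}\mathrm{cost}(S^g_i)-O^*|}{O^*}\le\beta$; $S_{ij}=\dot Y^*_{ij}|V_i|^2-\dot Y^*_{ij}V_iV_j^*$; and for each $v$ and each line in $E(v)\cup E^R(v)$: $\tilde\mu^v_{\mathbf g}/\lambda\le\dot g_{ij}\le\lambda\tilde\mu^v_{\mathbf g}$, $\tilde\mu^v_{\mathbf b}/\lambda\le\dot b_{ij}\le\lambda\tilde\mu^v_{\mathbf b}$. Output: $\dot{\mathcal{N}}$, identical to $\mathcal{N}$ except that the admittances are replaced by $\dot Y$. *)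

(* Defs.v *)
From HB Require Import structures.
From mathcomp Require Import all_boot all_order all_algebra.
From mathcomp Require Import complex.
From mathcomp Require Import all_classical all_reals all_analysis.

Set Implicit Arguments.
Unset Strict Implicit.
Unset Printing Implicit Defensive.

Import Order.TTheory GRing.Theory Num.Theory.
Local Open Scope ring_scope.
Local Open Scope classical_set_scope.

(* Buses are 'I_m, (directed) lines of E are 'I_n, voltage levels are 'I_k. *)
(* A directed edge of E \cup E^R is a pair (e, rev) : 'I_n * bool, where     *)
(* (e, false) is the line e = (fbus e, tbus e) in E and (e, true) is its    *)
(* reversal (tbus e, fbus e) in E^R.                                        *)
Record pub_network (R : realType) (m n k : nat) := PubNetwork {
  fbus  : 'I_n -> 'I_m;
  tbus  : 'I_n -> 'I_m;
  Sd    : 'I_m -> R[i];          (* demand S^d_i *)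
  Sgl   : 'I_m -> R[i];          (* generation lower bound S^{gl}_i *)
  Sgu   : 'I_m -> R[i];          (* generation upper bound S^{gu}_i *)
  vl    : 'I_m -> R;             (* voltage magnitude lower bound *)
  vu    : 'I_m -> R;             (* voltage magnitude upper bound *)
  thD   : 'I_n -> R;             (* phase-angle-difference limit of (i,j) in E *)
  su    : 'I_n -> bool -> R;     (* thermal limit s^u of a directed edge *)
  c0    : 'I_m -> R;
  c1    : 'I_m -> R;
  c2    : 'I_m -> R;
  slack : 'I_m;
  ratio : 'I_n -> R;             (* r_ij = b_ij / g_ij (public) *)
  level : 'I_n -> 'I_k
}.

Section PLO.
Variables (R : realType) (m n k : nat) (N : pub_network R m n k).

Definition cmod (z : R[i]) : R := Normc.normc z.

Definition angle_in (z : R[i]) (lo hi : R) : Prop :=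
  exists t : R, lo <= t <= hi /\
    z = Complex (cmod z * cos t) (cmod z * sin t).

Definition cle (x y : R[i]) : Prop :=
  complex.Re x <= complex.Re y /\ complex.Im x <= complex.Im y.

Definition gen_cost (i : 'I_m) (Sg : R[i]) : R :=
  c2 N i * (complex.Re Sg) ^+ 2 + c1 N i * complex.Re Sg + c0 N i.

Definition lines_at (v : 'I_k) : {set 'I_n} := [set e | level N e == v].
Definition n_at (v : 'I_k) : nat := #|lines_at v|.

(* Constraints of the optimization problem of step 4, for candidate
   admittances Ydot_e = gd e + i bd e (the same admittance is used for both
   directions of a line), given the noisy level means mug, mub. *)
Definition plo_feasible (Ostar beta lam : R) (mug mub : 'I_k -> R)
    (gd bd : 'I_n -> R) : Prop :=
  exists (Sg V : 'I_m -> R[i]) (S : 'I_n -> bool -> R[i]),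
  let Y e := Complex (gd e) (bd e) in
  angle_in (V (slack N)) 0 0 /\
      (forall i, vl N i <= cmod (V i) <= vu N i) /\
      (forall e, angle_in (V (fbus N e) * conjc (V (tbus N e)))
                          (- thD N e) (thD N e)) /\
      (forall i, cle (Sgl N i) (Sg i) /\ cle (Sg i) (Sgu N i)) /\
      (forall e r, cmod (S e r) <= su N e r) /\
      (forall i, Sg i - Sd N i =
          \sum_(e | fbus N e == i) S e false + \sum_(e | tbus N e == i) S e true) /\
      `|\sum_i gen_cost i (Sg i) - Ostar| / Ostar <= beta /\
      (forall e,
          S e false = conjc (Y e) * Complex (cmod (V (fbus N e)) ^+ 2) 0
                      - conjc (Y e) * V (fbus N e) * conjc (V (tbus N e)) /\
          S e true  = conjc (Y e) * Complex (cmod (V (tbus N e)) ^+ 2) 0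
                      - conjc (Y e) * V (tbus N e) * conjc (V (fbus N e))) /\
      (forall e, mug (level N e) / lam <= gd e <= lam * mug (level N e) /\
                 mub (level N e) / lam <= bd e <= lam * mub (level N e)).

(* objective ||gd - gt||^2 + ||bd - bt||^2 with bt_e = r_e * gt_e *)
Definition plo_obj (gt gd bd : 'I_n -> R) : R :=
  \sum_e ((gd e - gt e) ^+ 2 + (bd e - ratio N e * gt e) ^+ 2).

Definition plo_optimal (Ostar beta lam : R) (gt : 'I_n -> R)
    (mug mub : 'I_k -> R) (gd bd : 'I_n -> R) : Prop :=
  plo_feasible Ostar beta lam mug mub gd bd /\
  forall gd' bd', plo_feasible Ostar beta lam mug mub gd' bd' ->
    plo_obj gt gd bd <= plo_obj gt gd' bd'.

(* Noisy inputs of step 4: (g~, (mu~_g, mu~_b)), as tuples (product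
   sigma-algebra); outputs: (gdot, bdot). *)
Definition noisy_in := (n.-tuple R * (k.-tuple R * k.-tuple R))%type.
Definition plo_out := (n.-tuple R * n.-tuple R)%type.

Definition selection_rule (Ostar beta lam : R) (sel : noisy_in -> plo_out)
  : Prop :=
  forall x : noisy_in,
    let gt e := tnth x.1 e in
    let mug v := tnth x.2.1 v in
    let mub v := tnth x.2.2 v in
    (exists gd bd, plo_optimal Ostar beta lam gt mug mub gd bd) ->
    plo_optimal Ostar beta lam gt mug mub
      (fun e => tnth (sel x).1 e) (fun e => tnth (sel x).2 e).

End PLO.

Section Prob.
Variables (R : realType) (d : measure_display) (T : measurableType d)
  (P : probability T R).

Definition laplace_rv (lam' : R) (X : {RV P >-> R}) : Prop :=
  forall B : set R, measurable B ->
    P (X @^-1` B) =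
    (\int[lebesgue_measure]_(x in B) ((2 * lam')^-1 * expR (- `|x| / lam'))%:E)%E.

Definition mutually_independent (I : finType) (X : I -> {RV P >-> R}) : Prop :=
  forall B : I -> set R, (forall i, measurable (B i)) ->
    P (\bigcap_i (X i @^-1` B i)) = (\prod_(i : I) P (X i @^-1` B i))%E.

End Prob.

(* Noise index: inl e  -> z_e      ~ Lap(3 alpha / eps)         (step 1)     *)
(*              inr (inl v) -> noise of mu~^v_g ~ Lap(3 alpha/(n_v eps))     *)
(*              inr (inr v) -> noise of mu~^v_b ~ Lap(3 alpha/(n_v eps))     *)
Definition noise_idx (n k : nat) := ('I_n + ('I_k + 'I_k))%type.

Definition level_mean (R : realType) (m n k : nat) (N : pub_network R m n k)
    (x : 'I_n -> R) (v : 'I_k) : R :=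
  (n_at N v)%:R^-1 * \sum_(e in lines_at N v) x e.

Definition plo_noise_scale (R : realType) (m n k : nat)
    (N : pub_network R m n k) (alpha eps : R) (j : noise_idx n k) : R :=
  match j with
  | inl _ => 3 * alpha / eps
  | inr (inl v) | inr (inr v) => 3 * alpha / ((n_at N v)%:R * eps)
  end.

Definition plo_output (R : realType) (m n k : nat) (N : pub_network R m n k)
    (sel : noisy_in R n k -> plo_out R n)
    (d : measure_display) (T : measurableType d) (P : probability T R)
    (Z : noise_idx n k -> {RV P >-> R}) (g b : 'I_n -> R) (w : T)
  : plo_out R n :=
  sel ( [tuple g e + Z (inl e) w | e < n],
        ([tuple level_mean N g v + Z (inr (inl v)) w | v < k],
         [tuple level_mean N b v + Z (inr (inr v)) w | v < k]) ).

Definition alpha_adjacent (R : realType) (n : nat) (alpha : R)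
    (D D' : ('I_n -> R) * ('I_n -> R)) : Prop :=
  exists e : 'I_n,
    `|D.1 e - D'.1 e| <= alpha /\ `|D.2 e - D'.2 e| <= alpha /\
    forall e', e' != e -> D.1 e' = D'.1 e' /\ D.2 e' = D'.2 e'.

(* Main.v *)
(** The optimisation of step 4 sees the data only through the noisy vector
    [Z + q(D)], where [q(D)] lists the conductances and the level means. It is
    post-processing, so it suffices to compare the laws of [Z + q(D)] and
    [Z + q(D')]. Translating a Laplace variable of scale [l] by [t] multiplies
    its density by at most [exp (|t| / l)]. By independence these factors
    multiply on boxes, and since boxes form a semiring and the measure of a set
    is the infimum of the measures of its countable covers by boxes, the bound
    [exp (\sum_i |q_i(D) - q_i(D')| / l_i)] passes to all measurable sets.
    Changing one line by [alpha] moves one conductance by [alpha] and the two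
    means of its voltage level by [alpha / n_v], so each of the three noise
    families contributes [eps / 3]. *)

Require Import Defs.
From HB Require Import structures.
From mathcomp Require Import all_boot all_order all_algebra.
From mathcomp Require Import all_classical all_reals all_analysis.
From mathcomp Require Import measurable_realfun ring.

Set Implicit Arguments.
Unset Strict Implicit.
Unset Printing Implicit Defensive.

Import Order.TTheory GRing.Theory Num.Theory.
Local Open Scope ring_scope.
Local Open Scope classical_set_scope.

Section semiring_restriction.
Context d (T : semiRingOfSetsType d) (R : realType).
Local Notation sigmaT := (g_sigma_algebraType (@measurable d T)).

Definition semiring_restr (mu : set sigmaT -> \bar R) : set T -> \bar R := mu.

Section measure_instance.
Variable mu : {measure set sigmaT -> \bar R}.

Let semiring_restr0 : semiring_restr mu set0 = 0%E.
Proof. exact: measure0. Qed.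

Let semiring_restr_ge0 A : (0 <= semiring_restr mu A)%E.
Proof. exact: measure_ge0. Qed.

Let semiring_restr_semi_sigma_additive :
  semi_sigma_additive (semiring_restr mu).
Proof.
move=> F mF tF mUF; apply: (@measure_semi_sigma_additive _ _ _ mu) => //.
- by move=> i; apply: sub_sigma_algebra; exact: mF.
- exact: sub_sigma_algebra.
Qed.

HB.instance Definition _ := isMeasure.Build _ _ _ (semiring_restr mu)
  semiring_restr0 semiring_restr_ge0 semiring_restr_semi_sigma_additive.

End measure_instance.

Lemma le_measure_semiring (mu nu : {measure set sigmaT -> \bar R}) :
  sigma_finite [set: T] (semiring_restr nu) ->
  (forall A : set T, measurable A -> mu A <= nu A)%E ->
  forall A : set sigmaT, measurable A -> (mu A <= nu A)%E.
Proof.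
move=> nu_fin mu_le_nu A mA.
rewrite -(measure_extension_unique nu_fin (fun=> fun=> erefl))//.
apply: le_ereal_inf_tmp => _ [F [mF AF] <-].
have msF i : measurable (F i : set sigmaT).
  by apply: sub_sigma_algebra; exact: mF.
apply: (@le_trans _ _ (\sum_(i <oo) mu (F i))%E).
  exact: measure_sigma_subadditive.
by apply: lee_nneseries => i _ //; exact: mu_le_nu.
Qed.

End semiring_restriction.

Section boxes.
Context d (T : measurableType d) (I : finType).

Definition boxType : Type := I -> T.
HB.instance Definition _ := Pointed.on boxType.

Definition box (B : I -> set T) : set boxType := [set f | forall i, B i (f i)].

(* The empty set is not a box when [I] is empty. *)
Definition boxes : set (set boxType) :=
  [set set0] `|` [set box B | B in [set B | forall i, measurable (B i)]].

Lemma boxI (B C : I -> set T) :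
  box B `&` box C = box (fun i => B i `&` C i).
Proof.
apply/seteqP; split=> f; first by move=> [fB fC] i; split.
by move=> fBC; split=> i; case: (fBC i).
Qed.

Lemma boxT : box (fun=> setT) = setT.
Proof. by apply/seteqP; split. Qed.

Lemma boxes0 : boxes set0.
Proof. by left. Qed.

Lemma boxesT : boxes setT.
Proof. by right; exists (fun=> setT); rewrite // boxT. Qed.

Lemma boxesI : setI_closed boxes.
Proof.
move=> A A' [->|[B mB <-]]; first by rewrite set0I; left.
move=> [->|[C mC <-]]; first by rewrite setI0; left.
right; rewrite boxI; exists (fun i => B i `&` C i) => // i.
exact: measurableI.
Qed.

Definition subbox (B C : I -> set T) (J : {set I}) : set boxType :=
  box (fun i => if i \in J then B i `&` C i else B i `\` C i).

Lemma subboxE (B C : I -> set T) (J : {set I}) (f : boxType) :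
  subbox B C J f <-> box B f /\ J = [set i | `[< C i (f i) >]]%SET.
Proof.
split=> [fJ|[fB ->] i]; last by rewrite inE; case: asboolP; split.
split=> [i|]; first by have := fJ i; case: ifP => _ [].
apply/setP => i; rewrite inE; have := fJ i; case: ifP => _ [_ Cfi].
  by rewrite asboolT.
by rewrite asboolF.
Qed.

Lemma box_setD (B C : I -> set T) :
  box B `\` box C =
  \bigcup_(J in [set J : {set I} | J != [set: I]%SET]) subbox B C J.
Proof.
apply/seteqP; split=> [f [fB fC]|f [J /eqP JT /subboxE[fB JE]]].
- exists [set i | `[< C i (f i) >]]%SET; last exact/subboxE.
  apply/eqP => CT; apply: fC => i.
  by have := finset.in_setT i; rewrite -CT inE => /asboolP.
- by split=> // fC; apply: JT; rewrite JE; apply/setP => i; rewrite !inE;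
    exact/asboolP.
Qed.

Lemma boxesD : semi_setD_closed boxes.
Proof.
move=> A A' boxA [->|[C mC <-]].
  exists [set A]; split; rewrite ?setD0 ?bigcup_set1//.
    by move=> X ->.
  by move=> X Y -> ->.
case: boxA => [->|[B mB <-]].
  exists set0; split; rewrite ?set0D ?bigcup_set0//; exact: trivIset_set0.
exists [set subbox B C J | J in [set J | J != [set: I]%SET]]; split.
- exact/finite_image/finite_finset.
- move=> _ [J _ <-]; right.
  exists (fun i => if i \in J then B i `&` C i else B i `\` C i) => // i.
  by case: ifP => _; [exact: measurableI|exact: measurableD].
- by rewrite box_setD bigcup_image.
- by move=> _ _ [J _ <-] [K _ <-] [f [/subboxE[_ ->] /subboxE[_ ->]]].
Qed.

Definition box_display : measure_display -> measure_display. Proof. exact. Qed.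

HB.instance Definition _ := @isSemiRingOfSets.Build (box_display d)
  boxType boxes boxes0 boxesI boxesD.

Definition sigma_boxType := g_sigma_algebraType (@measurable _ boxType).

Lemma measurable_box_coord (i : I) :
  measurable_fun [set: sigma_boxType] (fun f : sigma_boxType => f i).
Proof.
move=> _ A mA; rewrite setTI; apply: sub_sigma_algebra; right.
exists (fun j => if j == i then A else setT) => [j|]; first by case: ifP.
apply/seteqP; split=> f /= fA; first by have := fA i; rewrite eqxx.
by move=> j; case: eqP => [->|].
Qed.

Lemma measurable_fun_box d' (T' : measurableType d') (f : T' -> sigma_boxType) :
  (forall i, measurable_fun [set: T'] (f ^~ i)) -> measurable_fun [set: T'] f.
Proof.
move=> mf; apply: (@measurability _ _ _ _ setT f boxes) => //.
move=> _ [_ [->|[B mB <-]] <-]; first by rewrite preimage_set0 setI0.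
rewrite setTI (_ : _ @^-1` _ = \bigcap_(i in [set: I]) (f ^~ i @^-1` B i)).
  apply: fin_bigcap_measurable => // i _.
  by rewrite -[_ @^-1` _]setTI; exact: mf.
by apply/seteqP; split=> [w fB i _|w fB i]; exact: fB.
Qed.

End boxes.

(* [D_oo(mu || nu) <= eps]; [eps]-differential privacy asks for it between the
   output laws of any two adjacent inputs. *)
Definition max_divergence_le d (T : measurableType d) (R : realType) (eps : R)
    (mu nu : set T -> \bar R) : Prop :=
  forall A, measurable A -> (mu A <= (expR eps)%:E * nu A)%E.

Section max_divergence.
Context (R : realType) d (T : measurableType d).

Lemma max_divergence_leW (eps eps' : R) (mu nu : {measure set T -> \bar R}) :
  eps <= eps' -> max_divergence_le eps mu nu -> max_divergence_le eps' mu nu.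
Proof.
move=> le_eps mu_nu A mA; apply: le_trans (mu_nu A mA) _.
by rewrite lee_wpmul2r// lee_fin ler_expR.
Qed.

Lemma max_divergence_le_pushforward d' (T' : measurableType d') (eps : R)
    (f : T -> T') (mu nu : set T -> \bar R) :
  measurable_fun setT f -> max_divergence_le eps mu nu ->
  max_divergence_le eps (pushforward mu f) (pushforward nu f).
Proof.
by move=> mf mu_nu A mA; apply: mu_nu; rewrite -[_ @^-1` _]setTI; exact: mf.
Qed.

Lemma max_divergence_le_density (mu : {measure set T -> \bar R}) (eps : R)
    (f g : T -> \bar R) :
  measurable_fun setT f -> measurable_fun setT g ->
  (forall x, 0 <= f x)%E -> (forall x, 0 <= g x)%E ->
  (forall x, f x <= (expR eps)%:E * g x)%E ->
  max_divergence_le eps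
    (fun A => \int[mu]_(x in A) f x)%E (fun A => \int[mu]_(x in A) g x)%E.
Proof.
move=> mf mg f0 g0 fg A mA.
have mgA : measurable_fun A g by exact: measurable_funTS.
rewrite -ge0_integralZl ?lee_fin ?expR_ge0//.
apply: ge0_le_integral => //; first exact: measurable_funTS.
exact: measurable_funeM.
Qed.

End max_divergence.

Lemma max_divergence_le_semiring d (T : semiRingOfSetsType d) (R : realType)
    (eps : R)
    (mu nu : {measure set g_sigma_algebraType (@measurable d T) -> \bar R}) :
  sigma_finite [set: T] (semiring_restr nu) ->
  (forall A : set T, measurable A -> mu A <= (expR eps)%:E * nu A)%E ->
  max_divergence_le eps mu nu.
Proof.
move=> [F FT nuF] mu_nu.
apply: (le_measure_semiring (nu := mscale (NngNum (expR_ge0 eps)) nu)) => //.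
exists F => // i; have [mF nuFi] := nuF i; split=> //.
by rewrite /semiring_restr /mscale /= lte_mul_pinfty ?lee_fin ?expR_ge0.
Qed.

Lemma lee_prod (R : realDomainType) (I : Type) (r : seq I) (P : pred I)
    (F G : I -> \bar R) :
  (forall i, P i -> 0 <= F i <= G i)%E ->
  (\prod_(i <- r | P i) F i <= \prod_(i <- r | P i) G i)%E.
Proof.
move=> FG; suff /andP[] :
  (0 <= \prod_(i <- r | P i) F i <= \prod_(i <- r | P i) G i)%E by [].
elim/big_rec2: _ => [|i y x Pi /andP[x0 xy]]; first by rewrite lee01 lexx.
by have /andP[F0 FGi] := FG i Pi; rewrite mule_ge0//= lee_pmul.
Qed.

Section joint_law.
Context (R : realType) d (T : measurableType d) (P : probability T R).
Variable I : finType.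

Definition joint (X : I -> {RV P >-> R}) (w : T) : sigma_boxType R I :=
  fun i => X i w.

Section joint_random_variable.
Variable X : I -> {RV P >-> R}.

Let measurable_joint : measurable_fun setT (joint X).
Proof. by apply: measurable_fun_box => i; exact: measurable_funP. Qed.

HB.instance Definition _ := isMeasurableFun.Build _ _ _ _ (joint X)
  measurable_joint.

End joint_random_variable.

Lemma distribution_joint_box (X : I -> {RV P >-> R}) (B : I -> set R) :
  mutually_independent X -> (forall i, measurable (B i)) ->
  (distribution P (joint X) (box B) = \prod_i distribution P (X i) (B i))%E.
Proof.
move=> indX mB; rewrite -indX//; congr (P _).
by apply/seteqP; split=> [w XB i _|w XB i]; exact: XB.
Qed.

Lemma mutually_independent_comp (X : I -> {RV P >-> R})
    (f : I -> {mfun R >-> R}) :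
  mutually_independent X ->
  mutually_independent (fun i => f i \o X i : {RV P >-> R}).
Proof.
move=> indX B mB; apply: (indX (fun i => f i @^-1` B i)) => i.
exact: measurable_funPTI.
Qed.

End joint_law.

Lemma max_divergence_le_joint (R : realType) (I : finType)
    d (T : measurableType d) (P : probability T R)
    d' (T' : measurableType d') (Q : probability T' R)
    (X : I -> {RV P >-> R}) (Y : I -> {RV Q >-> R}) (eps : I -> R) :
  mutually_independent X -> mutually_independent Y ->
  (forall i,
    max_divergence_le (eps i) (distribution P (X i)) (distribution Q (Y i))) ->
  max_divergence_le (\sum_i eps i)
    (distribution P (joint X)) (distribution Q (joint Y)).
Proof.
move=> indX indY XY.
apply: max_divergence_le_semiring.
  exists (fun=> setT) => [|_]; first by rewrite bigcup_const.
  split; first exact: boxesT.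
  by rewrite -[ltLHS]/(Q setT) probability_setT ltry.
move=> _ [->|[B mB <-]]; first by rewrite !measure0 mule0.
rewrite /= !distribution_joint_box// expR_sum -prodEFin -big_split/=.
by apply: lee_prod => i _; rewrite measure_ge0 XY.
Qed.

Section translation.
Context (R : realType).

Definition translate (c x : R) : R := x + c.

Let measurable_translate (c : R) : measurable_fun setT (translate c).
Proof. exact: measurable_funD. Qed.

HB.instance Definition _ (c : R) :=
  isMeasurableFun.Build _ _ _ _ (translate c) (measurable_translate c).

Lemma lebesgue_measure_translate (c : R) (A : set R) : measurable A ->
  pushforward lebesgue_measure (translate c) A = lebesgue_measure A.
Proof.
move=> mA; apply/esym.
apply: (@lebesgue_measure_unique R
  (pushforward lebesgue_measure (translate c : R -> measurableTypeR R))) => //.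
  exact: measurable_translate.
move=> ? _ [[a b] _ <-]; rewrite /= /pushforward.
rewrite (_ : _ @^-1` _ = `](a - c), (b - c)]%classic); last first.
  by apply/seteqP; split=> x /=; rewrite !in_itv/= ltrBlDr lerBrDr.
by rewrite !lebesgue_measure_itv/= !lte_fin ltrD2r -!EFinB opprB addrA subrK.
Qed.

Lemma ge0_integral_translate (c : R) (B : set R) (f : R -> \bar R) :
  measurable B -> measurable_fun [set: R] f -> (forall x, 0 <= f x)%E ->
  (\int[lebesgue_measure]_(x in translate c @^-1` B) f x =
   \int[lebesgue_measure]_(y in B) f (y - c)%R)%E.
Proof.
move=> mB mf f0.
have mfc : measurable_fun B (fun y => f (translate (- c) y)).
  by apply: measurable_funTS; exact: measurableT_comp.
transitivity (\int[pushforward lebesgue_measure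
    (translate c : R -> measurableTypeR R)]_(y in B) f (y - c)%R)%E; last first.
  apply: eq_measure_integral => [|? A mA _]; first exact: measurable_translate.
  exact: lebesgue_measure_translate.
rewrite ge0_integral_pushforward//=; last exact: measurable_translate.
by apply: eq_integral => x _ /=; rewrite /translate addrK.
Qed.

End translation.

Section laplace.
Context (R : realType).

Definition laplace_pdf (l x : R) : R := (2 * l)^-1 * expR (- `|x| / l).

Lemma laplace_pdf_ge0 (l x : R) : 0 < l -> 0 <= laplace_pdf l x.
Proof. by move=> l0; rewrite mulr_ge0 ?expR_ge0// invr_ge0 mulr_ge0// ltW. Qed.

Lemma measurable_laplace_pdf (l : R) : measurable_fun [set: R] (laplace_pdf l).
Proof.
apply: measurable_funM => //; apply: measurableT_comp => //.
by apply: measurable_funM => //; exact: measurableT_comp.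
Qed.

Lemma laplace_pdf_ratio_le (l x y : R) : 0 < l ->
  laplace_pdf l x <= expR (`|x - y| / l) * laplace_pdf l y.
Proof.
move=> l0; rewrite /laplace_pdf [leRHS]mulrCA.
apply: ler_wpM2l; first by rewrite invr_ge0 mulr_ge0// ltW.
rewrite -expRD ler_expR -mulrDl; apply: ler_wpM2r.
  by rewrite invr_ge0 ltW.
by rewrite lerBrDr addrC distrC lerB_dist.
Qed.

Context d (T : measurableType d) (P : probability T R).

Lemma distribution_translate_laplace (X : {RV P >-> R}) (l c : R) (B : set R) :
  0 < l -> laplace_rv l X -> measurable B ->
  distribution P (translate c \o X) B =
  (\int[lebesgue_measure]_(y in B) (laplace_pdf l (y - c)%R)%:E)%E.
Proof.
move=> l0 lapX mB.
rewrite -(@ge0_integral_translate _ c B (fun x => (laplace_pdf l x)%:E))//.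
- by rewrite -lapX//; exact: measurable_funPTI.
- by apply/measurable_EFinP; exact: measurable_laplace_pdf.
- by move=> x; rewrite lee_fin laplace_pdf_ge0.
Qed.

Lemma max_divergence_le_laplace (X : {RV P >-> R}) (l a b : R) :
  0 < l -> laplace_rv l X ->
  max_divergence_le (`|a - b| / l)
    (distribution P (translate a \o X)) (distribution P (translate b \o X)).
Proof.
move=> l0 lapX B mB; rewrite !(distribution_translate_laplace _ l0 lapX)//.
have mpdf c : measurable_fun [set: R] (fun y => (laplace_pdf l (y - c))%:E).
  apply/measurable_EFinP; apply: (measurableT_comp (measurable_laplace_pdf l)).
  exact: (measurable_funP (translate (- c))).
have pdf0 c y : (0 <= (laplace_pdf l (y - c))%:E)%E.
  by rewrite lee_fin laplace_pdf_ge0.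
apply: (@max_divergence_le_density _ _ _ lebesgue_measure _ _ _
  (mpdf a) (mpdf b)) => // y.
rewrite (_ : a - b = (y - b) - (y - a)); last by ring.
by rewrite distrC -EFinM lee_fin laplace_pdf_ratio_le.
Qed.

Variables (I : finType) (Z : I -> {RV P >-> R}) (l : I -> R).
Hypothesis Zind : mutually_independent Z.
Hypothesis l_gt0 : forall i, 0 < l i.
Hypothesis Zlap : forall i, laplace_rv (l i) (Z i).

Definition laplace_mechanism (q : I -> R) : {RV P >-> sigma_boxType R I} :=
  joint (fun i => translate (q i) \o Z i : {RV P >-> R}).

Lemma max_divergence_le_laplace_mechanism (q q' : I -> R) :
  max_divergence_le (\sum_i `|q i - q' i| / l i)
    (distribution P (laplace_mechanism q))
    (distribution P (laplace_mechanism q')).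
Proof.
apply: max_divergence_le_joint => [||i]; last exact: max_divergence_le_laplace.
- exact: mutually_independent_comp.
- exact: mutually_independent_comp.
Qed.

End laplace.

Section single_coordinate_change.
Context (I : finType) (i0 : I).

Lemma sum_sub_single (V : zmodType) (x x' : I -> V) (A : {set I}) :
  (forall i, i != i0 -> x i = x' i) ->
  \sum_(i in A) x i - \sum_(i in A) x' i =
  if i0 \in A then x i0 - x' i0 else 0.
Proof.
move=> xx'; rewrite -sumrB big_mkcond (bigD1 i0)//= big1 ?addr0// => i /xx' ->.
by rewrite subrr if_same.
Qed.

Lemma sum_dist_single (R : numDomainType) (x x' : I -> R) :
  (forall i, i != i0 -> x i = x' i) ->
  \sum_i `|x i - x' i| = `|x i0 - x' i0|.
Proof.
move=> xx'; rewrite (bigD1 i0)//= big1 ?addr0// => i /xx' ->.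
by rewrite subrr normr0.
Qed.

End single_coordinate_change.

Section sensitivity.
Context (R : realType) (m n k : nat) (N : pub_network R m n k).

Lemma sum_level_mean_dist_single (e0 : 'I_n) (x x' : 'I_n -> R) :
  (forall e, e != e0 -> x e = x' e) ->
  \sum_v (n_at N v)%:R * `|level_mean N x v - level_mean N x' v| =
  `|x e0 - x' e0|.
Proof.
move=> xx'.
have mean_sub v : level_mean N x v - level_mean N x' v =
    (n_at N v)%:R^-1 * (if e0 \in lines_at N v then x e0 - x' e0 else 0).
  by rewrite /level_mean -mulrBr (sum_sub_single _ xx').
rewrite (bigD1 (level N e0))//= big1 => [|v vl]; last first.
  by rewrite mean_sub inE eq_sym (negbTE vl) mulr0 normr0 mulr0.
have n_gt0 : (0 < n_at N (level N e0))%N.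
  by apply/card_gt0P; exists e0; rewrite inE.
by rewrite addr0 mean_sub inE eqxx normrM normfV normr_nat mulrA divff ?mul1r//
  pnatr_eq0 -lt0n.
Qed.

Definition plo_query (D : ('I_n -> R) * ('I_n -> R)) (j : noise_idx n k) : R :=
  match j with
  | inl e => D.1 e
  | inr (inl v) => level_mean N D.1 v
  | inr (inr v) => level_mean N D.2 v
  end.

Variables (alpha eps : R).

Lemma plo_noise_scale_gt0 (j : noise_idx n k) :
  0 < alpha -> 0 < eps -> (forall v, (0 < n_at N v)%N) ->
  0 < plo_noise_scale N alpha eps j.
Proof.
move=> alpha_gt0 eps_gt0 n_gt0.
by case: j => [e|[v|v]] /=; rewrite divr_gt0 ?mulr_gt0 ?ltr0n.
Qed.

Lemma sum_plo_query_dist (e0 : 'I_n) (D D' : ('I_n -> R) * ('I_n -> R)) :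
  (forall e, e != e0 -> D.1 e = D'.1 e /\ D.2 e = D'.2 e) ->
  \sum_j `|plo_query D j - plo_query D' j| / plo_noise_scale N alpha eps j =
  (`|D.1 e0 - D'.1 e0| + (`|D.1 e0 - D'.1 e0| + `|D.2 e0 - D'.2 e0|))
    * (eps / (3 * alpha)).
Proof.
move=> DD'.
have D1 e : e != e0 -> D.1 e = D'.1 e by move=> /DD'[].
have D2 e : e != e0 -> D.2 e = D'.2 e by move=> /DD'[].
rewrite big_sumType big_sumType /= [RHS]mulrDl [X in _ = _ + X]mulrDl.
congr (_ + (_ + _)).
- rewrite -(sum_dist_single D1) mulr_suml; apply: eq_bigr => e _.
  by rewrite invf_div.
- rewrite -(sum_level_mean_dist_single D1) mulr_suml; apply: eq_bigr => v _.
  by rewrite invf_div; ring.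
- rewrite -(sum_level_mean_dist_single D2) mulr_suml; apply: eq_bigr => v _.
  by rewrite invf_div; ring.
Qed.

Lemma sum_plo_query_dist_le (D D' : ('I_n -> R) * ('I_n -> R)) :
  0 < alpha -> 0 < eps -> alpha_adjacent alpha D D' ->
  \sum_j `|plo_query D j - plo_query D' j| / plo_noise_scale N alpha eps j
    <= eps.
Proof.
move=> alpha_gt0 eps_gt0 [e0 [D1_close [D2_close DD']]].
rewrite (sum_plo_query_dist DD').
have epsE : (alpha + (alpha + alpha)) * (eps / (3 * alpha)) = eps.
  by field; rewrite gt_eqF.
by rewrite -[leRHS]epsE ler_wpM2r ?lerD// divr_ge0 ?mulr_ge0 ?ltW.
Qed.

End sensitivity.

Definition noisy_in_of (R : realType) (n k : nat)
    (f : sigma_boxType R (noise_idx n k)) : noisy_in R n k :=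
  ([tuple f (inl e) | e < n],
   ([tuple f (inr (inl v)) | v < k], [tuple f (inr (inr v)) | v < k])).

Lemma measurable_noisy_in_of (R : realType) (n k : nat) :
  measurable_fun setT (@noisy_in_of R n k).
Proof.
have measurable_mktuple p (c : 'I_p -> noise_idx n k) :
    measurable_fun [set: sigma_boxType R (noise_idx n k)]
      (fun f => [tuple f (c i) | i < p]).
  apply/measurable_fun_tnthP => i.
  rewrite (_ : _ \o _ = fun f : sigma_boxType R _ => f (c i)).
    exact: measurable_box_coord.
  by apply/funext => f /=; rewrite tnth_mktuple.
apply: measurable_fun_pair; first exact: measurable_mktuple.
by apply: measurable_fun_pair; exact: measurable_mktuple.
Qed.

Lemma plo_outputE (R : realType) (m n k : nat) (N : pub_network R m n k)
    (sel : noisy_in R n k -> plo_out R n) (d : measure_display)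
    (T : measurableType d) (P : probability T R)
    (Z : noise_idx n k -> {RV P >-> R}) (D : ('I_n -> R) * ('I_n -> R)) :
  plo_output N sel Z D.1 D.2 =
  (sel \o @noisy_in_of R n k) \o laplace_mechanism Z (plo_query N D).
Proof.
apply/funext => w; congr (sel (_, (_, _)));
  by apply: eq_from_tnth => i; rewrite !tnth_mktuple addrC.
Qed.

Theorem theorem4 (R : realType) (m n k : nat) (N : pub_network R m n k)
    (Ostar alpha eps beta lam : R)
    (hO : 0 < Ostar) (ha : 0 < alpha) (he : 0 < eps) (hb : 0 < beta)
    (hl : 0 < lam)
    (hlev : forall v : 'I_k, (0 < n_at N v)%N)
    (sel : noisy_in R n k -> plo_out R n)
    (hsel : selection_rule N Ostar beta lam sel)
    (hselm : measurable_fun setT sel)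
    (d : measure_display) (T : measurableType d) (P : probability T R)
    (Z : noise_idx n k -> {RV P >-> R})
    (hZind : mutually_independent Z)
    (hZlap : forall j, laplace_rv (plo_noise_scale N alpha eps j) (Z j)) :
  forall (D D' : ('I_n -> R) * ('I_n -> R)),
    alpha_adjacent alpha D D' ->
    forall O : set (plo_out R n), measurable O ->
      (P (plo_output N sel Z D.1 D.2 @^-1` O)
       <= (expR eps)%:E * P (plo_output N sel Z D'.1 D'.2 @^-1` O))%E.
Proof.
move=> D D' adjDD' O mO; rewrite !plo_outputE.
have scale_gt0 j := plo_noise_scale_gt0 j ha he hlev.
have noisy_queries : max_divergence_le eps
    (distribution P (laplace_mechanism Z (plo_query N D)))
    (distribution P (laplace_mechanism Z (plo_query N D'))).
  apply: max_divergence_leW (sum_plo_query_dist_le N ha he adjDD') _.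
  exact: max_divergence_le_laplace_mechanism.
have measurable_postprocessing :
    measurable_fun setT (sel \o @noisy_in_of R n k).
  exact: measurableT_comp hselm (@measurable_noisy_in_of R n k).
exact: (max_divergence_le_pushforward measurable_postprocessing
  noisy_queries).
Qed.
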